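(* Let $u$ be a term that is not basic-zero, and let $G=G(u)$ be its quadratic graph, with marked set $W=W(u)$. Monomials already displayed in $u$ are always absorbed by $u$. Apart from them, the following list of absorbed monomials (''nontrivial absorbed monomials'') is exhaustive. (a) In $R_{01}$, if two marked vertices are joined by a path of odd length in $G$, then $u$ is identically $0$. Otherwise the nontrivial absorbed monomials are exactly the edges $xy$ (not displayed in $u$) with one endpoint in $W$ and the other in $O(W)$. (b) In $R_{02}$, if two marked vertices are joined by a path of odd length in $G$, then $u$ is identically $0$. Otherwise the nontrivial absorbed monomials are exactly the degree-one variables in $E(W)$ (not displayed in $u$). (c) In $R_{11}$, the nontrivial absorbed monomials are exactly the edges $xy$ (not displayed in $u$) such that $x$ and $y$ are joined by a path of odd length in $G$ and at least one of $x,y$ is marked. (d) In $R_{12}$, the nontrivial absorbed monomials are exactly the edges $xy$ (not displayed in $u$) such that $x$ and $y$ are joined by a path of odd length in $G$ and both $x$ and $y$ are marked.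
   Context: Let $M=\{0,c,p,q,a,b\}$ be the commutative semigroup whose only nonzero products are $pb=bp=ab=ba=aq=qa=c$ (every other product, including every square, is $0$). For $i,j\in\{0,1,2\}$, $R_{ij}$ is the semiring on $M$ with this multiplication whose addition is the join operation of the partial order on $M$ generated by $a<p<0$, $b<q<0$, $c<0$, together with: the first $i$ elements of the chain $a<p$ lie below $c$, and the first $j$ elements of the chain $b<q$ lie below $c$. Thus the additional comparisons are: $b<c$ in $R_{01}$; $b<q<c$ in $R_{02}$; $a<c$ and $b<c$ in $R_{11}$; $a<c$ and $b<q<c$ in $R_{12}$. Each $R_{ij}$ is a commutative additively idempotent semiring. Terms are in two binary operations $+,\cdot$ without constants; modulo the commutative ai-semiring axioms a term is a finite nonempty set (sum) of commutative monomials, its displayed monomials (summands). A monomial $w$ is absorbed by $u$ in a semiring $S$ if $S$ satisfies $w\preceq u$, i.e. $u+w\approx u$. ''$u$ is identically $0$'' means that $u$ takes the value $0\in M$ under every valuation (in which case every monomial is absorbed). For a term $u$: $M(u)$ is the set of variables occurring as linear (degree-one) summands; $G(u)$ is the graph whose edges are the square-free quadratic summands $xy$ ($x\ne y$) and whose vertices are only the variables incident with an edge; $W(u)=M(u)\cap V(G(u))$ is the set of marked vertices. A term is basic-zero if it contains a square, or a monomial of degree at least three, or if its quadratic graph contains an odd cycle. If $u$ is not basic-zero, $G(u)$ is bipartite; $E(W)$ (respectively $O(W)$) is the set of vertices of $G(u)$ at even (respectively odd) distance from $W$, i.e. joined to some vertex of $W$ by a path of even (respectively odd) length, a path of length zero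 being allowed for $E(W)$. An ''edge $xy$'' means a square-free quadratic monomial. *)

(* Defs.v *)
From HB Require Import structures.
From mathcomp Require Import all_boot finmap multiset.

Set Implicit Arguments.
Unset Strict Implicit.
Unset Printing Implicit Defensive.

Local Open Scope mset_scope.
Local Open Scope fset_scope.
Local Open Scope nat_scope.

Inductive carrier := M0 | Mc | Mp | Mq | Ma | Mb.

Definition ord_of_carrier (x : carrier) : 'I_6 :=
  match x with
  | M0 => inord 0 | Mc => inord 1 | Mp => inord 2
  | Mq => inord 3 | Ma => inord 4 | Mb => inord 5
  end.

Definition carrier_of_ord (k : 'I_6) : carrier := nth M0 [:: M0; Mc; Mp; Mq; Ma; Mb] k.

Lemma ord_of_carrierK : cancel ord_of_carrier carrier_of_ord.
Proof. by case; rewrite /carrier_of_ord inordK. Qed.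

HB.instance Definition _ := Finite.copy carrier (can_type ord_of_carrierK).

Definition M_mul (x y : carrier) : carrier :=
  match x, y with
  | Mp, Mb | Mb, Mp | Ma, Mb | Mb, Ma | Ma, Mq | Mq, Ma => Mc
  | _, _ => M0
  end.

(* The comparisons generating the order of R_ij; the order is their
   reflexive-transitive closure. *)
Definition R_gen_le (i j : nat) : rel carrier := fun x y =>
  match x, y with
  | Ma, Mp | Mp, M0 | Mb, Mq | Mq, M0 | Mc, M0 => true
  | Ma, Mc => 0 < i
  | Mp, Mc => 1 < i
  | Mb, Mc => 0 < j
  | Mq, Mc => 1 < j
  | _, _ => false
  end.

Definition R_le (i j : nat) : rel carrier := connect (R_gen_le i j).

Definition R_is_join (i j : nat) (x y z : carrier) : bool :=
  [&& R_le i j x z, R_le i j y z &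
      [forall t, R_le i j x t ==> R_le i j y t ==> R_le i j z t]].

(* The default value M0 is never used, see R_addP. *)
Definition R_add (i j : nat) (x y : carrier) : carrier :=
  odflt M0 [pick z | R_is_join i j x y z].

Inductive term :=
  | Var of nat
  | Add of term & term
  | Mul of term & term.

Fixpoint eval (i j : nat) (v : nat -> carrier) (t : term) : carrier :=
  match t with
  | Var x => v x
  | Add s t => R_add i j (eval i j v s) (eval i j v t)
  | Mul s t => M_mul (eval i j v s) (eval i j v t)
  end.

Definition satisfies (i j : nat) (s t : term) : Prop :=
  forall v : nat -> carrier, eval i j v s = eval i j v t.

(* Commutative monomials are multisets of variables, and a term, modulo the
   commutative ai-semiring axioms, is the finite set of its monomials. *)
Fixpoint summands (t : term) : {fset {mset nat}} :=
  match t with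
  | Var x => [fset [mset x]]
  | Add s t => summands s `|` summands t
  | Mul s t => [fset (m `+` n)%mset | m in summands s, n in summands t]
  end.

(* Equality modulo the commutative ai-semiring axioms. *)
Definition equiv (s t : term) : Prop := summands s = summands t.

(* w is a single monomial, up to the commutative ai-semiring axioms. *)
Definition monomial (w : term) : Prop := #|` summands w| = 1.

Definition displayed (u w : term) : Prop := (summands w `<=` summands u)%fset.

Definition absorbed (i j : nat) (u w : term) : Prop := satisfies i j (Add u w) u.

Definition nontrivial_absorbed (i j : nat) (u w : term) : Prop :=
  [/\ monomial w, absorbed i j u w & ~ displayed u w].

Definition identically_zero (i j : nat) (u : term) : Prop :=
  forall v : nat -> carrier, eval i j v u = M0.

Definition is_variable (w : term) (x : nat) : Prop := equiv w (Var x).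

Definition is_edge (w : term) (x y : nat) : Prop :=
  x <> y /\ equiv w (Mul (Var x) (Var y)).

Definition linear (u : term) (x : nat) : Prop := [mset x] \in summands u.

Definition adj (u : term) : rel nat := fun x y =>
  (x != y) && ([mset x; y] \in summands u).

Definition vertex (u : term) (x : nat) : Prop := exists y, adj u x y.

Definition marked (u : term) (x : nat) : Prop := linear u x /\ vertex u x.

(* size p is the length (number of edges) of the path x :: p. *)
Definition joined (parity : bool) (u : term) (x y : nat) : Prop :=
  exists p : seq nat,
    [/\ path (adj u) x p, uniq (x :: p), last x p = y & odd (size p) = parity].

Notation odd_joined := (joined true).
Notation even_joined := (joined false).

Definition even_from_marked (u : term) (x : nat) : Prop :=
  exists2 w, marked u w & even_joined u w x.

Definition odd_from_marked (u : term) (x : nat) : Prop :=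
  exists2 w, marked u w & odd_joined u w x.

Definition odd_marked_pair (u : term) : Prop :=
  exists x y, [/\ marked u x, marked u y & odd_joined u x y].

Definition has_odd_cycle (u : term) : Prop :=
  exists s : seq nat, [/\ ucycle (adj u) s, 2 < size s & odd (size s)].

Definition basic_zero (u : term) : Prop :=
  [\/ exists x : nat, [mset x; x] \in summands u,
      exists2 m : {mset nat}, m \in summands u & 3 <= size m
    | has_odd_cycle u].

(* The facts below establish that R_add is the join, that R_ij is a commutative
   ai-semiring, and hence that equiv terms take the same values. *)

Definition R_le_tab (i j : nat) (x y : carrier) : bool :=
  match x, y with
  | _, M0 | Mc, Mc | Mp, Mp | Mq, Mq | Ma, Ma | Mb, Mb | Ma, Mp | Mb, Mq => true
  | Ma, Mc => 0 < i
  | Mp, Mc => 1 < i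
  | Mb, Mc => 0 < j
  | Mq, Mc => 1 < j
  | _, _ => false
  end.

Lemma R_leE i j : R_le i j =2 R_le_tab i j.
Proof.
move=> x y; apply/idP/idP; last first.
  have g a b : R_gen_le i j a b -> R_le i j a b by apply: connect1.
  have t a b c : R_gen_le i j a b -> R_le i j b c -> R_le i j a c.
    by move/g; apply: connect_trans.
  case: x; case: y => //= h; try exact: connect0; try exact: g.
  - by apply: (t _ Mp) => //; apply: g.
  - by apply: (t _ Mq) => //; apply: g.
have refl a : R_le_tab i j a a by case: a.
have step a b c : R_gen_le i j a b -> R_le_tab i j b c -> R_le_tab i j a c.
  by clear refl; case: i => [|[|i]]; case: j => [|[|j]]; case: a; case: b; case: c.
case/connectP=> p; elim: p x => [|z p IH] x /=; first by move=> _ ->.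
by case/andP=> hxz /IH h /h; apply: step.
Qed.

Definition R_add_tab (i j : nat) (x y : carrier) : carrier :=
  if R_le_tab i j x y then y else if R_le_tab i j y x then x
  else if R_le_tab i j x Mc && R_le_tab i j y Mc then Mc else M0.

Lemma forall_carrier (p : pred carrier) :
  [forall x, p x] = [&& p M0, p Mc, p Mp, p Mq, p Ma & p Mb].
Proof.
apply/forallP/idP; first by move=> h; rewrite !h.
by case/and5P=> h1 h2 h3 h4 /andP[h5 h6] [].
Qed.

Lemma R_add_tabP i j x y : R_is_join i j x y (R_add_tab i j x y).
Proof.
rewrite /R_is_join forall_carrier !R_leE.
by case: i => [|[|i]]; case: j => [|[|j]]; case: x; case: y.
Qed.

Lemma R_addP i j x y : R_is_join i j x y (R_add i j x y).
Proof.
rewrite /R_add; case: pickP => [z //|h].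
by have := h (R_add_tab i j x y); rewrite R_add_tabP.
Qed.

Lemma R_le_anti i j x y : R_le i j x y -> R_le i j y x -> x = y.
Proof.
rewrite !R_leE; case: x; case: y => //=.
Qed.

Lemma R_addE i j : R_add i j =2 R_add_tab i j.
Proof.
move=> x y; have /and3P[h1 h2 /forallP h3] := R_addP i j x y.
have /and3P[k1 k2 /forallP k3] := R_add_tabP i j x y.
apply: (@R_le_anti i j).
  by have := h3 (R_add_tab i j x y); rewrite k1 k2.
by have := k3 (R_add i j x y); rewrite h1 h2.
Qed.

Lemma R_addA i j : associative (R_add i j).
Proof.
move=> x y z; rewrite !R_addE.
by case: i => [|[|i]]; case: j => [|[|j]]; case: x; case: y; case: z.
Qed.

Lemma R_addC i j : commutative (R_add i j).
Proof.
move=> x y; rewrite !R_addE.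
by case: i => [|[|i]]; case: j => [|[|j]]; case: x; case: y.
Qed.

Lemma R_addxx i j : idempotent_op (R_add i j).
Proof. by move=> x; rewrite R_addE; case: x. Qed.

Lemma M_mulA : associative M_mul.
Proof. by case; case; case. Qed.

Lemma M_mulC : commutative M_mul.
Proof. by case; case. Qed.

Lemma M_mul_addr i j : right_distributive M_mul (R_add i j).
Proof.
move=> x y z; rewrite !R_addE.
by case: i => [|[|i]]; case: j => [|[|j]]; case: x; case: y; case: z.
Qed.

Lemma R_le_add i j x y z : R_le i j (R_add i j x y) z = R_le i j x z && R_le i j y z.
Proof.
rewrite R_addE !R_leE.
by case: i => [|[|i]]; case: j => [|[|j]]; case: x; case: y; case: z.
Qed.

Lemma R_le_refl i j x : R_le i j x x.
Proof. exact: connect0. Qed.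

Definition mset_eval (v : nat -> carrier) (m : {mset nat}) : option carrier :=
  \big[oAC M_mulA M_mulC/None]_(x <- m) Some (v x).

Lemma mset_eval1 v x : mset_eval v [mset x] = Some (v x).
Proof. by rewrite /mset_eval enum_msetn big_seq1. Qed.

Lemma mset_evalD v m n : mset_eval v (m `+` n)%mset =
  oAC M_mulA M_mulC (mset_eval v m) (mset_eval v n).
Proof.
rewrite /mset_eval -big_cat /=; apply: perm_big.
by apply/allP=> x _ /=; rewrite count_cat !count_mem_mset msetE2.
Qed.

Lemma eval_ideal i j v (I : pred carrier) t :
  (forall x y, I (R_add i j x y) = I x && I y) ->
  I (eval i j v t) <->
  (forall m, m \in summands t -> oapp I false (mset_eval v m)).
Proof.
elim: t I => [x|s IHs t IHt|s IHs t IHt] I hI /=.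
- split=> [h m|/(_ [mset x])]; first by rewrite inE => /eqP->; rewrite mset_eval1.
  by rewrite inE eqxx mset_eval1; apply.
- rewrite hI; split=> [/andP[/IHs-/(_ hI) hs /IHt-/(_ hI) ht] m|h].
    by rewrite inE => /orP[/hs|/ht].
  apply/andP; split; [apply/(IHs _ hI)|apply/(IHt _ hI)] => m hm;
    by apply: h; rewrite inE hm ?orbT.
have hl y : forall a b, I (M_mul (R_add i j a b) y) = I (M_mul a y) && I (M_mul b y).
  by move=> a b; rewrite M_mulC M_mul_addr hI ![M_mul y _]M_mulC.
have hr y : forall a b, I (M_mul y (R_add i j a b)) = I (M_mul y a) && I (M_mul y b).
  by move=> a b; rewrite M_mul_addr hI.
rewrite (IHs (fun a => I (M_mul a _)) (hl _)); split=> [h k|h m hm].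
  case/imfset2P=> m /= hm [n /= hn ->]; rewrite mset_evalD.
  have := h m hm; case: (mset_eval v m) => //= a.
  by move/(IHt _ (hr a))/(_ n hn); case: (mset_eval v n).
have hmn n : n \in summands t ->
    oapp I false (oAC M_mulA M_mulC (mset_eval v m) (mset_eval v n)).
  by move=> hn; rewrite -mset_evalD; apply: h; apply: in_imfset2.
have sN u : forall n, n \in summands u -> isSome (mset_eval v n).
  elim: u => [x|p IHp q IHq|p IHp q IHq] n /=.
  - by rewrite inE => /eqP->; rewrite mset_eval1.
  - by rewrite inE => /orP[/IHp|/IHq].
  - case/imfset2P=> k /= /IHp hk [l /= /IHq hl' ->]; rewrite mset_evalD.
    by case: (mset_eval v k) hk => // a _; case: (mset_eval v l) hl'.
have := sN _ _ hm; case: (mset_eval v m) hmn => //= a hmn _.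
apply/(IHt _ (hr a)) => n hn; have := hmn n hn.
by have := sN _ _ hn; case: (mset_eval v n).
Qed.

(* The value of a term depends only on its set of monomials. *)
Lemma equiv_satisfies i j s t : equiv s t -> satisfies i j s t.
Proof.
move=> st v.
have h z : R_le i j (eval i j v s) z <-> R_le i j (eval i j v t) z.
  have hI x y := R_le_add i j x y z.
  rewrite (eval_ideal v s hI) (eval_ideal v t hI).
  by rewrite st.
by apply: (@R_le_anti i j); apply/h; apply: R_le_refl.
Qed.

(* Main.v *)
(* Once u has a quadratic summand its values lie in {c, 0}, so w is absorbed by
   u exactly when w(v) <= c for every valuation v with u(v) <= c ("valid" v).
   Under a valid v each vertex of G(u) takes a value in {a, p} or {b, q}, and
   these two sides 2-colour G(u); conversely a 2-colouring, together with an
   independent set of vertices taking p or q rather than a or b, gives a valid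
   valuation as soon as the marked vertices stay below c.  Absorption then
   amounts to what all admissible 2-colourings have in common, and this is found
   by exchanging the two colours on one connected component. *)

From mathcomp Require Import boolp.
Require Import Defs.
From mathcomp Require Import all_boot finmap multiset.

Set Implicit Arguments.
Unset Strict Implicit.
Unset Printing Implicit Defensive.

(** * Parity of walks and 2-colourings in a symmetric graph *)

Section Bipartite.
Variables (T : choiceType) (e : rel T).
Hypothesis e_sym : symmetric e.

(** Vertices may repeat, unlike in [joined], so that walks can be concatenated; [walk_uniq] recovers
    simple paths of the same parity. *)
Definition walk (b : bool) (x y : T) : Prop :=
  exists p : seq T, [/\ path e x p, last x p = y & odd (size p) = b].

Definition connected (x y : T) : Prop := exists b, walk b x y.

Definition proper (f : T -> bool) : Prop := forall x y, e x y -> f y = ~~ f x.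

Lemma walk0 x : walk false x x.
Proof. by exists [::]. Qed.

Lemma walk_edge x y : e x y -> walk true x y.
Proof. by move=> exy; exists [:: y]; rewrite /= exy. Qed.

Lemma walk_trans b c x y z : walk b x y -> walk c y z -> walk (b (+) c) x z.
Proof.
case=> p [pP <- <-] [q [qP <- <-]]; exists (p ++ q).
by rewrite cat_path pP qP last_cat size_cat oddD.
Qed.

Lemma walk_sym b x y : walk b x y -> walk b y x.
Proof.
case=> p [pP <- <-]; exists (rev (belast x p)); split.
- by rewrite rev_path; under eq_path do rewrite e_sym.
- by case: p {pP} => //= z p; rewrite rev_cons last_rcons.
- by rewrite size_rev size_belast.
Qed.

Lemma proper_walk f b x y : proper f -> walk b x y -> f y = f x (+) b.
Proof.
move=> fP [p [pP <- <-]]; elim: p x pP => [|z p IH] x /=; first by rewrite addbF.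
by case/andP=> /fP fz /IH->; rewrite fz addNb addbN.
Qed.

Lemma not_uniq_cat (s : seq T) : ~~ uniq s ->
  exists y s1 s2 s3, s = s1 ++ y :: s2 ++ y :: s3.
Proof.
elim: s => //= x s IH; rewrite negb_and negbK; case/orP=> [/path.splitPr[s2 s3]|/IH].
  by exists x, [::], s2, s3.
by case=> y [s1 [s2 [s3 ->]]]; exists y, (x :: s1), s2, s3.
Qed.

(* A closed walk with a repeated vertex splits into two shorter closed walks,
   one of which is odd if the original one is. *)
Lemma odd_closed_walk_cycle x : irreflexive e -> walk true x x ->
  exists s : seq T, [/\ ucycle e s, 2 < size s & odd (size s)].
Proof.
move=> e_irr [p [+ + op]].
have [n] := ubnP (size p); elim: n => // n IH in x p op * => /ltnSE lpn pP lp.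
case: (boolP (uniq p)) => [up|].
  (* As the walk returns to [x], the list [p] without its starting point already lists the cycle. *)
  exists p; split=> //.
    rewrite /ucycle up (cycle_path x) andbT.
    by case: p op lp pP {lpn up} => //= z p _ ->.
  (* The only odd length below three is one, which would be a loop. *)
  case: p op pP lp {lpn up} => [|y [|z [|w p]]] //= _ /andP[+ _] yx.
  by rewrite yx e_irr.
case/not_uniq_cat=> y [s1 [s2 [s3 Ep]]]; rewrite {}Ep in op lpn pP lp.
move: pP; rewrite cat_path /= cat_path /= => /and5P[P1 e1 P2 e2 P3].
move: lp; rewrite last_cat /= last_cat /= => lp.
have sz : size (s1 ++ y :: s2 ++ y :: s3) = size (rcons s2 y) + size (s1 ++ y :: s3).
  by rewrite !(size_cat, size_rcons) /= size_cat /= addnCA !addSn !addnS.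
move: op; rewrite sz oddD; case: (boolP (odd (size (rcons s2 y)))) => [o2 _|o2 /= o1].
  apply: (IH y (rcons s2 y)) => //; rewrite ?last_rcons ?rcons_path ?P2 //.
  by apply: leq_trans lpn; rewrite sz -addn1 leq_add2l size_cat /= addnS.
apply: (IH x (s1 ++ y :: s3)) => //; rewrite ?last_cat ?cat_path ?P1 /= ?e1 //.
by apply: leq_trans lpn; rewrite sz size_rcons addSn ltnS leq_addl.
Qed.

(** The two hypotheses exclude the only obstructions. The set [S] will be empty or the set of marked
    vertices, when these must all receive the same colour. *)
Lemma proper_exists (S : T -> Prop) : (forall x, ~ walk true x x) ->
  (forall x y, S x -> S y -> ~ walk true x y) ->
  exists2 f, proper f & forall x, S x -> f x = false.
Proof.
move=> noC noS.
(* The value at x is the parity of the walks from x to a representative of its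
   component, chosen in S whenever S meets the component. *)
pose Q x := [pred y | `[< connected x y /\
  (S y \/ forall z, connected x z -> ~ S z) >]].
have exQ x : exists y, Q x y.
  case: (pselect (exists2 y, connected x y & S y)) => [[y xy Sy]|nS].
    by exists y; apply/asboolP; split=> //; left.
  exists x; apply/asboolP; split; first by exists false; apply: walk0.
  by right=> z xz Sz; apply: nS; exists z.
pose r x := xchoose (exQ x).
have rP x : connected x (r x) by have /asboolP[] := xchooseP (exQ x).
have rS x : S x -> S (r x).
  move=> Sx; have /asboolP[_ [//|/(_ x) nS]] := xchooseP (exQ x).
  by case: nS => //; exists false; apply: walk0.
(* Adjacent vertices lie in the same component, so [Q x] and [Q y] agree pointwise, and [xchoose]
   depends only on the extension of the predicate. *)
have r_edge x y : e x y -> r x = r y.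
  move=> exy; apply: eq_xchoose => z.
  have tr u v w : e u v -> connected v w -> connected u w.
    by move=> /walk_edge uv [b /(walk_trans uv)]; exists (true (+) b).
  have eyx : e y x by rewrite e_sym.
  apply/asboolP/asboolP => -[yz [Sz|nS]]; (split; first exact: tr yz);
    by [left|right=> t /tr-/(_ _ ltac:(eassumption)); apply: nS].
have one b x y : walk b x y -> walk (~~ b) x y -> False.
  move=> /walk_sym yx xy; apply: (noC y).
  by have := walk_trans yx xy; rewrite addbN addbb.
exists (fun x => `[< walk true x (r x) >]) => [x y exy|x Sx]; last first.
  by apply/asboolPn; apply: noS => //; apply: rS.
rewrite -(r_edge _ _ exy); have [b xr] := rP x.
have yr : walk (~~ b) y (r x).
  by rewrite -addTb; apply: walk_trans xr; apply/walk_sym/walk_edge.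
have val c z : walk c z (r x) -> `[< walk true z (r x) >] = c.
  by case: c => h; [apply/asboolP|apply/asboolPn => /one; apply].
by rewrite (val _ _ yr) (val _ _ xr).
Qed.

(** Exchanging the colours on the whole component of [x] is harmless because no edge leaves the
    component. *)
Lemma proper_flip f x : proper f -> exists2 g, proper g &
  g x = ~~ f x /\ forall y, ~ connected x y -> g y = f y.
Proof.
move=> fP; exists (fun y => f y (+) `[< connected x y >]).
  move=> y z eyz; rewrite (fP _ _ eyz) addNb; congr (~~ (_ (+) _)).
  have tr c u v : e u v -> connected c u -> connected c v.
    by move=> /walk_edge uv [b /walk_trans/(_ uv)]; exists (b (+) true).
  by apply/asboolP/asboolP; apply: tr => //; rewrite e_sym.
split=> [|y nxy]; last by have /asboolPn/negbTE-> := nxy; rewrite addbF.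
have /asboolP-> : connected x x by exists false; apply: walk0.
by rewrite addbT.
Qed.

(* Removing loops preserves the parity, since a 2-colouring determines it. *)
Lemma walk_uniq f b x y : proper f -> walk b x y ->
  exists p : seq T, [/\ path e x p, uniq (x :: p), last x p = y & odd (size p) = b].
Proof.
move=> fP xy; have fxy := proper_walk fP xy; case: xy => p [pP lp _].
case: (shortenP pP) lp => q qP uq _ lq; exists q; split=> //.
have : walk (odd (size q)) x y by exists q.
by move/(proper_walk fP); rewrite fxy => /addbI.
Qed.

End Bipartite.

(** * Monomials by degree and their values *)

Lemma mset_small (m : {mset nat}%mset) : m <> mset0 ->
  [\/ exists x, m = [mset x]%mset, exists x y, m = [mset x; y]%mset | 3 <= size m].
Proof.
rewrite -{1 2 3}(seq_mset_id m); case: (m : seq nat) => [|x [|y [|z s]]] h.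
- by case: h; apply/msetP => a; rewrite mset_seqE mset0E.
- constructor 1; exists x; apply/msetP => a.
  by rewrite mset_seqE msetnE /= addn0 eq_sym.
- constructor 2; exists x, y; apply/msetP => a.
  by rewrite mset_seqE msetE2 !msetnE /= addn0 ![a == _]eq_sym.
- by constructor 3.
Qed.

Lemma mset_eval2 v x y :
  mset_eval v [mset x; y]%mset = Some (M_mul (v x) (v y)).
Proof. by rewrite mset_evalD !mset_eval1. Qed.

(** A product of two elements is [c] or [0], and both of these annihilate everything. *)
Lemma mset_eval3 v (m : {mset nat}%mset) : 3 <= size m -> mset_eval v m = Some M0.
Proof.
rewrite /mset_eval; case: (m : seq nat) => [|x [|y [|z s]]] // _.
rewrite !big_cons; case: (\big[_/_]_(_ <- s) _) => [t|] /=; congr Some;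
  by case: (v x); case: (v y); case: (v z) => //; case: t.
Qed.

(** Terms have no constants; this supplies the hypothesis of [mset_small]. *)
Lemma summands_neq0 t m : m \in summands t -> m <> mset0.
Proof.
elim: t m => [x|s IHs t IHt|s IHs t IHt] m /=.
- by move=> /fset1P-> /msetP/(_ x); rewrite msetnxx mset0E.
- by case/fsetUP => [/IHs|/IHt].
case/imfset2P=> k /= /IHs hk [l _ ->] h; apply: hk; apply/msetP => a.
by move/msetP/(_ a): h; rewrite msetE2 !mset0E; case: (k a).
Qed.

Lemma summands_mul_var x y :
  summands (Mul (Var x) (Var y)) = [fset [mset x; y]%mset]%fset.
Proof.
apply/fsetP => n; apply/imfset2P/fset1P => [[p + [q]]|->].
  by move=> /fset1P-> /fset1P-> ->.
by exists [mset x]%mset; rewrite ?fset11 //; exists [mset y]%mset; rewrite ?fset11.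
Qed.

(** * Absorption in terms of valuations giving a term a value below [c] *)

Section Evaluation.
Variables (i j : nat) (u : term).
Implicit Types (v : nat -> carrier) (z : carrier).

Lemma R_le_trans y x z : R_le i j x y -> R_le i j y z -> R_le i j x z.
Proof. exact: connect_trans. Qed.

Lemma eval_le v t z : R_le i j (eval i j v t) z <->
  forall m, m \in summands t -> oapp (R_le i j ^~ z) false (mset_eval v m).
Proof. by apply: eval_ideal => x y; apply: R_le_add. Qed.

Lemma absorbedP w :
  absorbed i j u w <-> forall v, R_le i j (eval i j v w) (eval i j v u).
Proof.
split=> h v; have /= := h v.
  by move=> <-; have /and3P[] := R_addP i j (eval i j v u) (eval i j v w).
move=> le_wu; apply: (@R_le_anti i j); first by rewrite R_le_add R_le_refl.
by have /and3P[] := R_addP i j (eval i j v u) (eval i j v w).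
Qed.

Lemma displayed_absorbed w : displayed u w -> absorbed i j u w.
Proof.
move=> /fsubsetP wu; apply/absorbedP => v; apply/eval_le => m /wu.
by have /eval_le := R_le_refl i j (eval i j v u); apply.
Qed.

Lemma M_mul_le x y z : R_le i j (M_mul x y) z -> R_le i j Mc z.
Proof. by rewrite !R_leE; case: x; case: y; case: z. Qed.

Lemma M_mul_leMc x y : R_le i j (M_mul x y) Mc <-> M_mul x y = Mc.
Proof. by rewrite R_leE; case: x; case: y. Qed.

(** Only linear and square-free quadratic summands are constrained, since a term that is not
    basic-zero has no others. A product is [c] or [0], so below [c] it equals [c]. *)
Definition valid v : Prop :=
  (forall x, linear u x -> R_le i j (v x) Mc) /\
  (forall x y, adj u x y -> M_mul (v x) (v y) = Mc).

Lemma eval_valid v : R_le i j (eval i j v u) Mc -> valid v.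
Proof.
move/eval_le => h; split=> [x /h|x y /andP[_ /h]]; first by rewrite mset_eval1.
by rewrite mset_eval2 => /M_mul_leMc.
Qed.

Lemma valid_eval v : ~ basic_zero u -> valid v -> R_le i j (eval i j v u) Mc.
Proof.
move=> hu [v1 v2]; apply/eval_le => m mu.
case: (mset_small (summands_neq0 mu)) => [[x Em]|[x [y Em]]|m3].
- by rewrite Em mset_eval1; apply: v1; rewrite /linear -Em.
- have [xy|nxy] := eqVneq x y.
    by case: hu; constructor 1; exists x; rewrite {2}xy -Em.
  by rewrite Em mset_eval2; apply/M_mul_leMc/v2; rewrite /adj nxy -Em.
- by case: hu; constructor 2; exists m.
Qed.

Lemma vertex_eval v x : vertex u x -> R_le i j Mc (eval i j v u).
Proof.
case=> y /andP[_ xy]; apply: (@M_mul_le (v x) (v y)).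
have /eval_le/(_ _ xy) := R_le_refl i j (eval i j v u).
by rewrite mset_eval2.
Qed.

(** An edge of the graph forces the value of [u] to be [c] or [0]. At [0] everything is absorbed,
    and the value [c] makes the valuation valid. *)
Lemma absorbed_valid w x : vertex u x ->
  (forall v, valid v -> R_le i j (eval i j v w) Mc) -> absorbed i j u w.
Proof.
move=> /vertex_eval ux h; apply/absorbedP => v; have := ux v; rewrite R_leE.
case E: (eval i j v u) => // _; first by rewrite R_leE; case: (eval i j v w).
by apply/h/eval_valid; rewrite E R_le_refl.
Qed.

Lemma identically_zero_valid x : vertex u x -> (forall v, ~ valid v) ->
  identically_zero i j u.
Proof.
move=> /vertex_eval ux h v; have := ux v; rewrite R_leE.
case E: (eval i j v u) => // _; case: (h v).
by apply/eval_valid; rewrite E R_le_refl.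
Qed.

Lemma variable_eval w x v : is_variable w x -> eval i j v w = v x.
Proof. by move/(equiv_satisfies i j)/(_ v). Qed.

Lemma edge_eval w x y v : is_edge w x y -> eval i j v w = M_mul (v x) (v y).
Proof. by case=> _ /(equiv_satisfies i j)/(_ v). Qed.

(** * Valid valuations and 2-colourings *)

Definition side z : bool := if z is (Ma | Mp) then true else false.

(** Every nonzero product has one factor in {[a], [p]} and the other in {[b], [q]}. *)
Lemma valid_proper v : valid v -> proper (adj u) (side \o v).
Proof. by case=> _ h x y /h /=; case: (v x); case: (v y). Qed.

Lemma valid_vertex v x : valid v -> vertex u x -> v x <> M0 /\ v x <> Mc.
Proof. by case=> _ h [y /h]; case: (v x). Qed.

Lemma valid_marked v x : valid v -> marked u x -> R_le_tab i j (v x) Mc.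
Proof. by case=> h _ [/h + _]; rewrite R_leE. Qed.

(* f is the side of a vertex; P holds when it takes p or q rather than a or b. *)
Definition label (f P : bool) : carrier :=
  if f then if P then Mp else Ma else if P then Mq else Mb.

(** Outside the graph, a linear variable takes the largest value allowed, [c], and any other
    variable takes [0]. Both values annihilate every product. *)
Definition labelling (f P : nat -> bool) (x : nat) : carrier :=
  if `[< vertex u x >] then label (f x) (P x)
  else if `[< linear u x >] then Mc else M0.

(** The set [P] must be independent because [pq = 0]; all other products of opposite sides are
    [c]. *)
Definition good (f P : nat -> bool) : Prop :=
  [/\ proper (adj u) f,
      forall x y, adj u x y -> ~~ (P x && P y) &
      forall x, marked u x -> R_le_tab i j (label (f x) (P x)) Mc].

Lemma adj_sym : symmetric (adj u).
Proof. by move=> x y; rewrite /adj eq_sym msetDC. Qed.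

Lemma good_valid f P : good f P -> valid (labelling f P).
Proof.
case=> fP PP mP; rewrite /labelling; split=> [x lx|x y xy].
case: asboolP => [vx|_]; first by rewrite R_leE; apply: mP (conj lx vx).
  by case: asboolP => // _; apply: R_le_refl.
have vx : vertex u x by exists y.
have vy : vertex u y by exists x; rewrite adj_sym.
rewrite !asboolT // (fP _ _ xy); have := PP _ _ xy.
by case: (f x); case: (P x); case: (P y).
Qed.

(** One good labelling suffices to restrict the shape of [w]: variables outside the graph annihilate
    products, an undisplayed such variable has value [0], and so do squares and monomials of degree
    at least three. The final conditions then express that [w] stays below [c] under every good
    labelling. *)
Lemma nontrivial_absorbed_cases w : ~ basic_zero u ->
    nontrivial_absorbed i j u w -> (exists f P, good f P) ->
  (exists x, [/\ is_variable w x, vertex u x, ~ linear u x &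
     forall f P, good f P -> R_le_tab i j (label (f x) (P x)) Mc]) \/
  (exists x y, [/\ is_edge w x y, vertex u x /\ vertex u y, ~ adj u x y &
     forall f P, good f P -> f y = ~~ f x /\ ~~ (P x && P y)]).
Proof.
move=> hu [/eqP/cardfs1P[m Ew] /absorbedP aw nd] [f0 [P0 g0]].
have le f P : good f P ->
    oapp (R_le i j ^~ Mc) false (mset_eval (labelling f P) m).
  move=> /good_valid/(valid_eval hu)/(R_le_trans (aw _))/eval_le; apply.
  by rewrite Ew inE.
have nmu : m \notin summands u.
  by apply/negP => mu; apply: nd; rewrite /displayed Ew fsub1set.
have m0 : m <> mset0 by apply: (@summands_neq0 w); rewrite Ew inE.
case: (mset_small m0) => [[x Em]|[x [y Em]]|m3]; rewrite ?{}Em in le nmu Ew.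
- have vx : vertex u x.
    apply/asboolP/negPn/negP => nvx; have := le _ _ g0.
    rewrite mset_eval1 /labelling (negbTE nvx) asboolF /= ?R_leE //.
    exact/negP.
  left; exists x; split=> //; first exact/negP.
  by move=> f P /le; rewrite mset_eval1 /labelling asboolT //= R_leE.
- have le2 f P : good f P -> M_mul (labelling f P x) (labelling f P y) = Mc.
    by move=> /le; rewrite mset_eval2 => /M_mul_leMc.
  have vx : vertex u x.
    apply/asboolP/negPn/negP => /negbTE nvx; have := le2 _ _ g0.
    by rewrite /labelling nvx; case: ifP.
  have vy : vertex u y.
    apply/asboolP/negPn/negP => /negbTE nvy; have := le2 _ _ g0.
    by rewrite M_mulC /labelling nvy; case: ifP.
  right; exists x, y; split=> //.
  + split; last by rewrite /Defs.equiv summands_mul_var -Ew.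
    move=> xy; have := le2 _ _ g0; rewrite xy.
    by case: (labelling _ _ _).
  + by case/andP => _ /(negP nmu).
  + move=> f P /le2; rewrite /labelling !asboolT //.
    by case: (f x); case: (f y); case: (P x); case: (P y).
- by have := le _ _ g0; rewrite (mset_eval3 _ m3) /= R_leE.
Qed.

End Evaluation.

(** * Connectivity forced by all admissible 2-colourings of [G(u)] *)

Section NontrivialAbsorbed.
Variable u : term.
Hypothesis hu : ~ basic_zero u.

Lemma no_odd_closed_walk x : ~ walk (adj u) true x x.
Proof.
move=> xx; apply: hu; constructor 3; apply: (odd_closed_walk_cycle _ xx).
by move=> y; rewrite /adj eqxx.
Qed.

Lemma proper_adj : exists f, proper (adj u) f.
Proof.
have [f fP _] := @proper_exists _ _ (adj_sym u) (fun=> False)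
  no_odd_closed_walk (fun _ _ h => False_ind _ h).
by exists f.
Qed.

(** Loops can be cut out of a walk without changing its parity, as the graph is bipartite. *)
Lemma joinedP b x y : joined b u x y <-> walk (adj u) b x y.
Proof.
split=> [[p [pP _ lp bp]]|]; first by exists p.
have [f fP] := proper_adj; exact: walk_uniq fP.
Qed.

Lemma joined_sym b x y : joined b u x y -> joined b u y x.
Proof. by move/joinedP/(walk_sym (adj_sym u))/joinedP. Qed.

Lemma is_edge_sym w x y : is_edge w x y -> is_edge w y x.
Proof.
case=> xy wxy; split; first exact: nesym.
by rewrite /Defs.equiv summands_mul_var msetDC -summands_mul_var.
Qed.

Lemma joined_vertex x y : odd_joined u x y -> vertex u x /\ vertex u y.
Proof.
have left z t : odd_joined u z t -> vertex u z.
  by case=> -[|a p] [] //= /andP[za _] _ _ _; exists a.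
by move=> xy; split; [apply: left xy|apply: left (joined_sym xy)].
Qed.

Lemma proper_marked : ~ odd_marked_pair u ->
  exists2 f, proper (adj u) f & forall x, marked u x -> f x = false.
Proof.
move=> nopair; apply: (@proper_exists _ _ (adj_sym u) (marked u)) => [|x y mx my].
  exact: no_odd_closed_walk.
by move/joinedP => xy; apply: nopair; exists x, y.
Qed.

Lemma is_edge_monomial w x y : is_edge w x y -> monomial w.
Proof.
by case=> _; rewrite /Defs.equiv /monomial summands_mul_var => ->; apply: cardfs1.
Qed.

Lemma is_variable_monomial w x : is_variable w x -> monomial w.
Proof. by rewrite /is_variable /Defs.equiv /monomial => ->; apply: cardfs1. Qed.

(** The sets [pred1] and [pred2] put [p] or [q] exactly on the variables of a tested monomial, in
    order to push its value out of the elements below [c]. *)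
Lemma independent1 x y z : adj u y z -> ~~ (pred1 x y && pred1 x z).
Proof.
move=> yz; apply/negP => /andP[/eqP y_x /eqP z_x]; move: yz.
by rewrite y_x z_x /adj eqxx.
Qed.

Lemma independent2 x y z t : ~ adj u x y -> adj u z t ->
  ~~ (pred2 x y z && pred2 x y t).
Proof.
move=> nxy zt; apply/negP => /andP[/pred2P zxy /pred2P txy]; move: zt.
by case: zxy txy => -> [] ->; rewrite 1?(adj_sym u y x) // /adj eqxx.
Qed.

(** If no marked vertex reaches [x] with parity [f x], then none reaches it at all, since marked
    vertices have colour [false]. Flipping the component of [x] then changes [f x] but no marked
    colour. *)
Lemma marked_reach f x : proper (adj u) f ->
    (forall z, marked u z -> f z = false) ->
    (forall g, proper (adj u) g -> (forall z, marked u z -> g z = false) ->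
      g x = f x) ->
  exists2 z, marked u z & joined (f x) u z x.
Proof.
move=> fP fm fx; apply: contrapT => nr.
have [g gP [gx gf]] := proper_flip (adj_sym u) x fP.
have: g x = f x; last by rewrite gx; case: (f x).
apply: fx => // z mz; rewrite gf ?fm // => -[b /(walk_sym (adj_sym u)) zx].
apply: nr; exists z => //; apply/joinedP.
by rewrite (proper_walk fP zx) fm.
Qed.

(** Were [x] and [y] in different components, flipping that of [y] would give them equal colours; in
    the same component, the colours determine the parity. *)
Lemma odd_reach x y : (forall f, proper (adj u) f -> f y = ~~ f x) ->
  odd_joined u x y.
Proof.
move=> h; have [f fP] := proper_adj; apply: contrapT => nr.
have [g gP [gy gf]] := proper_flip (adj_sym u) y fP.
have: g y = ~~ g x by apply: h.
rewrite gy gf ?h //; first by case: (f x).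
move=> [b /(walk_sym (adj_sym u)) xy]; apply: nr; apply/joinedP.
have := proper_walk fP xy; rewrite h //.
by case: b xy => // _; case: (f x).
Qed.

Lemma proper_true x : exists2 f, proper (adj u) f & f x = true.
Proof.
have [f fP] := proper_adj; have [g gP [gx _]] := proper_flip (adj_sym u) x fP.
by case E: (f x) gx => gx; [exists f|exists g].
Qed.

Lemma good_pred0 i j f : proper (adj u) f ->
    (forall x, marked u x -> R_le_tab i j (label (f x) false) Mc) ->
  good i j u f pred0.
Proof. by []. Qed.

Lemma good_pred1 i j f x : proper (adj u) f ->
    (forall z, marked u z -> R_le_tab i j (label (f z) (z == x)) Mc) ->
  good i j u f (pred1 x).
Proof. by move=> fP mP; split=> // y z; apply: independent1. Qed.

Lemma good_pred2 i j f x y : proper (adj u) f -> ~ adj u x y ->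
    (forall z, marked u z ->
      R_le_tab i j (label (f z) ((z == x) || (z == y))) Mc) ->
  good i j u f (pred2 x y).
Proof. by move=> fP nxy mP; split=> // z t; apply: independent2. Qed.

(** * Absorption in the four semirings *)

Lemma marked_valid_side j v x : valid 0 j u v -> marked u x -> side (v x) = false.
Proof.
move=> vv mx; have := valid_marked vv mx; have [] := valid_vertex vv mx.2.
by case: (v x).
Qed.

(** With [i = 0] neither [a] nor [p] is below [c], so both marked vertices lie on the side {[b],
    [q]}, while the odd path puts them on opposite sides: no valuation is valid. *)
Lemma odd_marked_pair_zero j : odd_marked_pair u -> identically_zero 0 j u.
Proof.
case=> x [y [mx my /joinedP xy]].
apply: (@identically_zero_valid 0 j u x) => [|v vv]; first by case: mx.
have := proper_walk (valid_proper vv) xy.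
by rewrite /= (marked_valid_side vv mx) (marked_valid_side vv my).
Qed.

(** Marked vertices take the value [b], and [ab = pb = c]. So an edge is absorbed when one endpoint
    is marked and the other is forced onto the side {[a], [p]}. *)
Lemma absorbed_R01 w : ~ odd_marked_pair u ->
  nontrivial_absorbed 0 1 u w <->
  exists x y : nat,
    [/\ is_edge w x y, ~ displayed u w, marked u x & odd_from_marked u y].
Proof.
move=> nopair; split=> [aw|[x [y [wxy nd mx [z mz zy]]]]]; last first.
  split=> //; first exact: is_edge_monomial wxy.
  apply: (absorbed_valid mx.2) => v vv; rewrite (edge_eval _ _ _ wxy).
  have := proper_walk (valid_proper vv) ((joinedP _ _ _).1 zy).
  rewrite /= (marked_valid_side vv mz) R_leE.
  have := marked_valid_side vv mx; have := valid_marked vv mx.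
  have := valid_vertex vv (joined_vertex zy).2; have := valid_vertex vv mx.2.
  by case: (v x) => [] [] //; case: (v y) => [] // _ _ [].
have [f0 f0P f0m] := proper_marked nopair.
have g0 f : proper (adj u) f -> (forall x, marked u x -> f x = false) ->
    good 0 1 u f pred0.
  by move=> fP fm; apply: good_pred0 => // x /fm->.
case: (nontrivial_absorbed_cases hu aw) => [|[x [_ vx nlx /(_ f0 (pred1 x))]]|].
- by exists f0, pred0; apply: g0.
- rewrite /= eqxx => h; have {h}: R_le_tab 0 1 (label (f0 x) true) Mc;
    last by case: (f0 x).
  apply: h; apply: good_pred1 => // z mz; rewrite f0m //.
  by case: eqP => // zx; case: nlx; rewrite -zx; case: mz.
case=> x [y [wxy _ nadj h]].
(* Stated for [s] and [t] because either endpoint of [w] may be the marked one. *)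
have key s t : is_edge w s t -> marked u s ->
    (forall f P, good 0 1 u f P -> f t = ~~ f s) ->
  exists x y, [/\ is_edge w x y, ~ displayed u w, marked u x & odd_from_marked u y].
  move=> wst ms {}h; exists s, t; split=> //; first by case: aw.
  have ft f : proper (adj u) f -> (forall x, marked u x -> f x = false) -> f t = true.
    by move=> fP fm; rewrite (h f pred0) ?fm //; apply: g0.
  have := @marked_reach f0 t f0P f0m; rewrite ft //; apply=> g gP gm.
  exact: ft.
have [mx|nmx] := pselect (marked u x).
  by apply: (key x y wxy mx) => f P /h[].
have [my|nmy] := pselect (marked u y).
  by apply: (key y x (is_edge_sym wxy) my) => f P /h[-> _]; rewrite negbK.
(* Unmarked endpoints may both take values in {[p], [q]}, and such a product is [0]. *)
have [] := h f0 (pred2 x y); last by rewrite /= !eqxx orbT.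
apply: good_pred2 => // z mz; rewrite f0m //.
case: eqP => [zx|_]; first by case: nmx; rewrite -zx.
by case: eqP => // zy; case: nmy; rewrite -zy.
Qed.

(** Both [b] and [q] are below [c], so a variable forced onto the side of the marked vertices is
    absorbed. Marked vertices may also take [q], hence no undisplayed edge is absorbed. *)
Lemma absorbed_R02 w : ~ odd_marked_pair u ->
  nontrivial_absorbed 0 2 u w <->
  exists x : nat, [/\ is_variable w x, ~ displayed u w & even_from_marked u x].
Proof.
move=> nopair; split=> [aw|[x [wx nd [z mz zx]]]]; last first.
  split=> //; first exact: is_variable_monomial wx.
  apply: (absorbed_valid mz.2) => v vv; rewrite (variable_eval _ _ _ wx).
  have := proper_walk (valid_proper vv) ((joinedP _ _ _).1 zx).
  rewrite /= (marked_valid_side vv mz) R_leE.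
  (* A path of length zero gives [x = z], a marked vertex; otherwise the last edge of the path makes
     [x] a vertex. *)
  have : v x <> M0.
    case: zx => p [pP _ lp _]; case/lastP: p pP lp => [_ <-|p t].
      by case: (valid_vertex vv mz.2).
    rewrite rcons_path last_rcons => /andP[_ px] tx.
    have /(valid_vertex vv)[] // : vertex u x.
    by exists (last z p); rewrite adj_sym -tx.
  by case: (v x).
have [f0 f0P f0m] := proper_marked nopair.
have g0 f : proper (adj u) f -> (forall x, marked u x -> f x = false) ->
    good 0 2 u f pred0.
  by move=> fP fm; apply: good_pred0 => // x /fm->.
case: (nontrivial_absorbed_cases hu aw) => [|[x [wx vx nlx h]]|].
- by exists f0, pred0; apply: g0.
- have fx f : proper (adj u) f -> (forall x, marked u x -> f x = false) -> f x = false.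
    move=> fP fm; have: R_le_tab 0 2 (label (f x) true) Mc; last by case: (f x).
    have := h f (pred1 x); rewrite /= eqxx; apply; apply: good_pred1 => // z /fm->.
    by case: (z == x).
  exists x; split=> //; first by case: aw.
  have := @marked_reach f0 x f0P f0m; rewrite fx //; apply=> g gP gm; exact: fx.
case=> x [y [_ _ nadj /(_ f0 (pred2 x y))]].
rewrite /= !eqxx orbT => -[] //; apply: good_pred2 => // z /f0m->.
by case: (_ || _).
Qed.

(** Marked vertices take [a] or [b], so marks restrict [P] but not the 2-colouring. One marked
    endpoint already excludes the product [pq]. *)
Lemma absorbed_R11 w :
  nontrivial_absorbed 1 1 u w <->
  exists x y : nat,
    [/\ is_edge w x y, ~ displayed u w, odd_joined u x y &
        marked u x \/ marked u y].
Proof.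
split=> [aw|[x [y [wxy nd xy mxy]]]]; last first.
  split=> //; first exact: is_edge_monomial wxy.
  have [vx vy] := joined_vertex xy.
  apply: (absorbed_valid vx) => v vv; rewrite (edge_eval _ _ _ wxy).
  have := proper_walk (valid_proper vv) ((joinedP _ _ _).1 xy).
  have := valid_vertex vv vx; have := valid_vertex vv vy.
  rewrite /= R_leE; case: mxy => /(valid_marked vv);
    by case: (v x) => //; case: (v y) => // _ [] // _ _ [].
have [f0 f0P] := proper_adj.
have g0 f : proper (adj u) f -> good 1 1 u f pred0.
  by move=> fP; apply: good_pred0 => // x _; case: (f x).
case: (nontrivial_absorbed_cases hu aw) => [|[x [_ vx nlx /(_ f0 (pred1 x))]]|].
- by exists f0, pred0; apply: g0.
- rewrite /= eqxx => h; have {h}: R_le_tab 1 1 (label (f0 x) true) Mc;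
    last by case: (f0 x).
  apply: h; apply: good_pred1 => // z mz.
  case: eqP => [zx|_]; last by case: (f0 z).
  by case: nlx; rewrite -zx; case: mz.
case=> x [y [wxy _ nadj h]]; exists x, y; split=> //; first by case: aw.
  by apply: odd_reach => f /g0/h[].
apply: contrapT => nm; have [] := h f0 (pred2 x y); last by rewrite /= !eqxx orbT.
apply: good_pred2 => // z mz; case: eqP => [zx|_].
  by case: nm; left; rewrite -zx.
case: eqP => [zy|_]; last by case: (f0 z).
by case: nm; right; rewrite -zy.
Qed.

(** Marks exclude only the value [p]. An unmarked endpoint could be coloured to take [p] and the
    other endpoint given [q], so both must be marked. *)
Lemma absorbed_R12 w :
  nontrivial_absorbed 1 2 u w <->
  exists x y : nat,
    [/\ is_edge w x y, ~ displayed u w, odd_joined u x y &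
        marked u x /\ marked u y].
Proof.
split=> [aw|[x [y [wxy nd xy [mx my]]]]]; last first.
  split=> //; first exact: is_edge_monomial wxy.
  apply: (absorbed_valid mx.2) => v vv; rewrite (edge_eval _ _ _ wxy).
  have := proper_walk (valid_proper vv) ((joinedP _ _ _).1 xy).
  have := valid_vertex vv mx.2; have := valid_vertex vv my.2.
  rewrite /= R_leE; have := valid_marked vv mx; have := valid_marked vv my.
  by case: (v x) => //; case: (v y) => // _ _ [] // _ _ [].
have [f0 f0P] := proper_adj.
have g0 f : proper (adj u) f -> good 1 2 u f pred0.
  by move=> fP; apply: good_pred0 => // x _; case: (f x).
case: (nontrivial_absorbed_cases hu aw) => [|[x [_ vx nlx h]]|].
- by exists f0, pred0; apply: g0.
(* The colour [true] is needed here: it gives [x] the value [p], whereas [q] is below [c]. *)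
- have [f fP fx] := proper_true x.
  have := h f (pred1 x); rewrite /= eqxx fx => {}h; have // : false; apply: h.
  apply: good_pred1 => // z mz.
  case: eqP => [zx|_]; last by case: (f z).
  by case: nlx; rewrite -zx; case: mz.
case=> x [y [wxy _ nadj h]]; exists x, y.
have key s t : ~ adj u s t ->
    (forall f P, good 1 2 u f P -> f t = ~~ f s /\ ~~ (P s && P t)) -> marked u s.
  move=> nst {}h; apply: contrapT => nm; have [f fP fs] := proper_true s.
  have [ft _] := h _ _ (g0 f fP).
  have [] := h f (pred2 s t); last by rewrite /= !eqxx orbT.
  apply: good_pred2 => // z mz; case: eqP => [zs|_]; first by case: nm; rewrite -zs.
  by case: eqP => [->|_]; [rewrite ft fs|case: (f z)].
split=> //; first by case: aw.
  by apply: odd_reach => f /g0/h[].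
split; first exact: key nadj h.
apply: (key y x) => [|f P /h[-> nP]]; first by rewrite adj_sym.
by rewrite negbK andbC.
Qed.

End NontrivialAbsorbed.

Theorem theorem3p1 (u : term) (hu : ~ basic_zero u) :
  (forall i j : nat, i <= 2 -> j <= 2 ->
     forall w : term, monomial w -> displayed u w -> absorbed i j u w) /\
  ((odd_marked_pair u -> identically_zero 0 1 u) /\
   (~ odd_marked_pair u ->
    forall w : term,
      nontrivial_absorbed 0 1 u w <->
      exists x y : nat,
        [/\ is_edge w x y, ~ displayed u w, marked u x & odd_from_marked u y])) /\
  ((odd_marked_pair u -> identically_zero 0 2 u) /\
   (~ odd_marked_pair u ->
    forall w : term,
      nontrivial_absorbed 0 2 u w <->
      exists x : nat,
        [/\ is_variable w x, ~ displayed u w & even_from_marked u x])) /\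
  (forall w : term,
     nontrivial_absorbed 1 1 u w <->
     exists x y : nat,
       [/\ is_edge w x y, ~ displayed u w, odd_joined u x y &
           marked u x \/ marked u y]) /\
  (forall w : term,
     nontrivial_absorbed 1 2 u w <->
     exists x y : nat,
       [/\ is_edge w x y, ~ displayed u w, odd_joined u x y &
           marked u x /\ marked u y]).
Proof.
split=> [i j _ _ w _|]; first exact: displayed_absorbed.
split; first by split=> [|nopair w]; [exact: odd_marked_pair_zero|exact: absorbed_R01].
split; first by split=> [|nopair w]; [exact: odd_marked_pair_zero|exact: absorbed_R02].
by split=> w; [exact: absorbed_R11|exact: absorbed_R12].
Qed.
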